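(* Let $\Omega=\{x\in\mathbb{R}^2 : |x|<1\}$ be the open unit disk in $\mathbb{R}^2$. Given any $\delta>0$ and any function $\phi:[0,\delta]\rightarrow\mathbb{R}$ satisfying $\phi(0)=0$, $\phi(t)>0$ for $0<t\leq\delta$, and $\phi(t)\searrow 0$ as $t\searrow 0$, there exist a smooth, strictly convex function $u:\bar{\Omega}\rightarrow\mathbb{R}$ and a Lipschitz function $h:\Omega\rightarrow\mathbb{R}$ compactly supported in $\Omega$, satisfying $|\Omega\setminus\Omega_c|=0$, where $\Omega_c$ is the union of all open subsets of $\Omega$ on which $h$ is convex, such that $$\liminf_{t\searrow 0}\frac{u_t(0)-(u_t)^{**}(0)}{t\,\phi(t)}>0,$$ where $u_t=u+th$ on $\Omega$ and $(u_t)^{**}$ denotes the $\Gamma$-regularization of $u_t$.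
   Context: For a bounded open set $\Omega\subset\mathbb{R}^n$ and a bounded function $w:\Omega\rightarrow\mathbb{R}$, the $\Gamma$-regularization of $w$ is the function $w^{**}:\mathbb{R}^n\rightarrow\mathbb{R}$ defined as the (pointwise) supremum of all affine functions on $\mathbb{R}^n$ which are less than or equal to $w$ on $\Omega$. (For $\Omega$ the unit disk, inside $\Omega$ the function $w^{**}$ equals the largest convex function less than or equal to $w$.) For a measurable set $A\subset\mathbb{R}^2$, $|A|$ denotes its Lebesgue measure. In $u_t(0)$ and $(u_t)^{**}(0)$, $0$ denotes the origin of $\mathbb{R}^2$. *)

(* Defs.v *)
From HB Require Import structures.
From mathcomp Require Import all_boot all_order all_algebra.
From mathcomp Require Import all_classical all_reals all_analysis.

Set Implicit Arguments.
Unset Strict Implicit.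
Unset Printing Implicit Defensive.

Import Order.TTheory GRing.Theory Num.Theory.
Import numFieldNormedType.Exports.

Local Open Scope classical_set_scope.
Local Open Scope ring_scope.

(* The plane is [R * R]. A function on a subset of the plane is represented by
   a total function [R * R -> R], only whose values on that subset matter. *)

(* The norm that the library puts on [R * R] is the sup norm, so the Euclidean
   norm defining the disk is spelled out. *)
Definition enorm (R : realType) (x : R * R) : R :=
  Num.sqrt (x.1 ^+ 2 + x.2 ^+ 2).

Definition unit_disk (R : realType) : set (R * R) := [set x | enorm x < 1].
Arguments unit_disk R : clear implicits.

Definition plane_measure (R : realType) : set (R * R) -> \bar R :=
  (@lebesgue_measure R \x @lebesgue_measure R)%E.

Definition coord_vec (R : realType) (i : bool) : R * R :=
  if i then (0, 1) else (1, 0).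

Definition iter_partial (R : realType) (s : seq bool) (f : R * R -> R) :
    R * R -> R :=
  foldr (fun i g => 'D_(coord_vec R i) g) f s.

(* Meant for open [U]: partial derivatives at the points of [U] then depend
   only on the values of [f] in [U]. *)
Definition smooth_on_open (R : realType) (U : set (R * R)) (f : R * R -> R) :=
  forall (s : seq bool) (x : R * R), U x ->
    {for x, continuous (iter_partial s f)} /\
    (forall i : bool, derivable (iter_partial s f) x (coord_vec R i)).

(* On a non-open set: the restriction of a smooth function defined on an open
   neighbourhood of the set. *)
Definition smooth_on (R : realType) (A : set (R * R)) (f : R * R -> R) :=
  exists (U : set (R * R)) (g : R * R -> R),
    [/\ open U, A `<=` U, smooth_on_open U g & {in A, f =1 g}].

Definition strictly_convex_on (R : realType) (V : lmodType R) (A : set V)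
    (f : V -> R) :=
  forall (x y : V) (t : R), A x -> A y -> x <> y -> 0 < t -> t < 1 ->
    f (t *: x + (1 - t) *: y) < t * f x + (1 - t) * f y.

(* The closure is taken in the whole space, so that being contained in [A]
   forbids the support from reaching the boundary of [A]. *)
Definition compactly_supported_in (T : topologicalType) (R : realType)
    (A : set T) (f : T -> R) :=
  let S := closure [set x | A x /\ f x <> 0] in compact S /\ S `<=` A.

Definition affine_function (R : realType) (V : lmodType R) (a : V -> R) :=
  exists (l : {scalar V}) (c : R), forall x, a x = l x + c.

(* For [w] bounded on a nonempty [A], the set of values is nonempty, and at a
   point [x] of [A] it is bounded above by [w x], so there [sup] is the genuine
   supremum. At points where the set is unbounded above (e.g. outside the
   closure of a disk [A]), [sup] takes the default value 0. *)
Definition Gamma_reg (R : realType) (V : lmodType R) (A : set V) (w : V -> R)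
    (x : V) : R :=
  sup [set a x | a in [set a : V -> R |
                        affine_function a /\ forall y, A y -> a y <= w y]].

(* [convex_function U h] asks for the convexity inequality for all points of
   [U], also when [U] is not a convex set. Requiring it only along the segments
   contained in [U], or only for convex [U], yields the same union, because an
   open set is a union of balls. *)
Definition convexity_region (R : realType) (A : set (R * R)) (h : R * R -> R) :
    set (R * R) :=
  \bigcup_(U in [set U : set (R * R) |
                  [/\ open U, U `<=` A & convex_function U h]]) U.

(* Main.v *)
Require Import Defs.
From HB Require Import structures.
From mathcomp Require Import all_boot all_order all_algebra ring lra.
From mathcomp Require Import all_classical all_reals all_analysis.
From mathcomp Require Import measurable_realfun.

Set Implicit Arguments.
Unset Strict Implicit.
Unset Printing Implicit Defensive.

Import Order.TTheory GRing.Theory Num.Theory.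
Import numFieldNormedType.Exports.

Local Open Scope classical_set_scope.
Local Open Scope ring_scope.

(** The function [h] is the pyramid [max(0, 1/2 - |x|)] for the sup norm [|.|]
    ([pyramid]). It has a concave peak at the origin, yet on each of the four
    sectors cut out by the diagonals it is the maximum of two affine functions,
    so it is locally convex off the two diagonals, a null set
    ([plane_measure_nonconvexity_pyramid]).

    An affine minorant of [u + t h] is, at the origin, at most the average of
    [u + t h] over two opposite points [(s, 0)] and [(- s, 0)]
    ([Gamma_reg_midpoint_le]). If [u] vanishes at [0] and is symmetric, the gap
    at the origin is therefore at least [t s - u (s, 0)] for every [s] up to
    [1/2]. Taking [s = phi t] gives a gap of at least [t * phi t / 2] as soon as
    [u (phi t, 0) <= t * phi t / 2]: all that is needed is a smooth, strictly
    convex [u] that is flat enough at [0], at a rate prescribed by [phi].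

    Such a flatness is obtained by averaging translates of one flat function.
    Let [theta y = y * exp (- 1 / y)] for [y > 0], and [theta y = 0] otherwise
    ([flat_exp 0]). It is smooth, nondecreasing, convex, and strictly convex as
    soon as one of the two points compared is positive. Put
    [F x = \int_0^delta theta (x - phi r) dr] ([flat_convex]). At [x = phi t]
    the integrand vanishes for [r > t], because [phi] is nondecreasing; hence
    [F (phi t) <= t * theta (phi t)], which is below [t * phi t / 2] when
    [phi t] is small ([flat_convex_le]). Differentiation under the integral sign
    makes [F] smooth ([smooth_shift_average]), and strict convexity passes to
    the average because [phi r] is smaller than any given positive number on
    some interval [0, t1] of positive length
    ([strictly_convex_flat_convex]).

    Finally [u x = F x.1 + F (- x.1) + F x.2 + F (- x.2)] ([axial_sum]): two
    distinct points differ in some coordinate, and along it one of [F],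
    [F \o -%R] is strictly convex between them. *)

(** * A smooth convex function that is flat on the negative half-line *)

Section FlatExponential.
Variable R : realType.
Implicit Types (x y z t : R) (n : nat).

(** The function [y ^ (1 - n) * exp (- 1 / y)] for positive [y], extended by [0]:
    up to linear combinations, this family is closed under differentiation. *)
Definition flat_exp n y : R :=
  if 0 < y then y * y^-1 ^+ n * expR (- y^-1) else 0.

Lemma flat_exp_le0 n y : y <= 0 -> flat_exp n y = 0.
Proof. by rewrite /flat_exp ltNge => ->. Qed.

Lemma flat_exp_ge0 n y : 0 <= flat_exp n y.
Proof.
rewrite /flat_exp; case: ifPn => // y0.
by rewrite !mulr_ge0 ?expR_ge0 ?exprn_ge0 ?invr_ge0 ?ltW.
Qed.

(** With [z = 1 / y], the bound is [z ^ (n + 1) * exp (- z) <= (n + 1)!], one term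
    of the exponential series. A quadratic bound is what makes the derivative at
    [0] exist and vanish. *)
Lemma flat_exp_le_sqr n y : `|flat_exp n y| <= n.+1`!%:R * y ^+ 2.
Proof.
rewrite ger0_norm ?flat_exp_ge0//.
have [y0|y0] := leP y 0.
  by rewrite flat_exp_le0// mulr_ge0 ?ler0n ?sqr_ge0.
have zK : y * y^-1 = 1 by rewrite divff// gt_eqF.
rewrite /flat_exp y0 (_ : _ * _ * _ = y^-1 ^+ n.+1 * expR (- y^-1) * y ^+ 2).
  rewrite ler_wpM2r ?sqr_ge0// expRN ler_pdivrMr ?expR_gt0//.
  have := @expR_ge1Dxn R y^-1 n; rewrite invr_ge0 ltW// => /(_ isT) h.
  rewrite mulrC -ler_pdivrMr ?ltr0n ?fact_gt0//.
  by apply: le_trans h; rewrite lerDr.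
rewrite exprS expr2.
have -> : y^-1 * y^-1 ^+ n * expR (- y^-1) * (y * y) =
  (y * y^-1) * (y * y^-1 ^+ n * expR (- y^-1)) by ring.
by rewrite zK mul1r.
Qed.

Lemma is_derive_le_sqr (f : R -> R) (C : R) :
  (forall y, `|f y| <= C * y ^+ 2) -> is_derive (0 : R) (1 : R) f 0.
Proof.
move=> fC.
have C0 : 0 <= C by have := fC 1; rewrite expr1n mulr1; exact: le_trans.
have f0 : f 0 = 0.
  by apply/eqP; rewrite -normr_le0; have := fC 0; rewrite expr0n mulr0.
suff H : h^-1 *: (f (h *: 1 + 0) - f 0) @[h --> (0:R)^'] --> (0 : R).
  by apply: DeriveDef; [apply/cvg_ex; exists 0 | exact: cvg_lim H].
apply: norm_cvg0.
apply: (@squeeze_cvgr _ _ _ _ (cst 0) (fun h => C * `|h|)).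
- near=> h; rewrite normr_ge0/= addr0 f0 subr0 scaler1 normrZ normfV.
  have h0 : h != 0 by near: h; exact: nbhs_dnbhs_neq.
  rewrite ler_pdivrMl ?normr_gt0//.
  by have := fC h; rewrite -[h ^+ 2]real_normK ?num_real// expr2; lra.
- exact: cvg_cst.
- apply: cvg_within_filter.
  have : (fun h : R => C * `|h|) @ (0 : R) --> C * `|0 : R|.
    by apply: cvgMr; exact: norm_continuous.
  by rewrite normr0 mulr0.
Unshelve. all: by end_near. Qed.

Lemma is_derive_flat_exp n y :
  is_derive y (1 : R) (flat_exp n)
    ((1 - n%:R) * flat_exp n.+1 y + flat_exp n.+2 y).
Proof.
have [y0|y0|->] := ltgtP y 0.
- rewrite !(@flat_exp_le0 _ y) ?ltW// mulr0 addr0.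
  apply: (@near_eq_is_derive _ _ _ (cst (0 : R))).
  near=> z; rewrite flat_exp_le0//.
  by apply: ltW; near: z; exact: lt_nbhsl.
- have yn0 : y != 0 by rewrite gt_eqF.
  have dV : is_derive y (1 : R) (fun z => z^-1) (- y ^- 2 *: 1).
    exact: (@is_deriveV R id).
  have dX := @is_deriveX _ _ (fun z => z^-1) n y 1 _ dV.
  have dN := @is_deriveN _ _ _ (fun z => z^-1) y 1 _ dV.
  have dE := @is_derive1_comp _ expR (fun z => - z^-1) y _ _ (is_derive_expR _) dN.
  have dM := @is_deriveM _ _ id _ y 1 _ _ (is_derive_id _ _) dX.
  have dMM := @is_deriveM _ _ _ _ y 1 _ _ dM dE.
  apply: (near_eq_is_derive _ (is_derive_eq dMM _)).
    near=> z; rewrite /flat_exp ifT ?fctE//.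
    by near: z; exact: lt_nbhsr.
  rewrite /flat_exp y0 /=.
  have vE : ((fun z : R => z^-1) ^+ n) y = y^-1 ^+ n by rewrite exprfctE.
  have idvE : (id * (fun z : R => z^-1) ^+ n) y = y * y^-1 ^+ n.
    by rewrite -vE.
  rewrite vE idvE /GRing.scale/= -exprVn.
  move: (mulfV yn0); move: (y^-1) (expR _) => z e yz1.
  apply/eqP; rewrite -subr_eq0; apply/eqP.
  transitivity (e * z ^+ n * (1 - y * z)); last by rewrite yz1 subrr mulr0.
  by case: (n) => [|k] /=; rewrite !exprS; ring.
- rewrite !(@flat_exp_le0 _ 0)// mulr0 addr0.
  exact: is_derive_le_sqr (flat_exp_le_sqr n).
Unshelve. all: by end_near. Qed.

(** Linear combinations of the [flat_exp n], encoded by lists of pairs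
    (coefficient, index), so that differentiation becomes the list operation
    [deriv_flat_sum]. *)
Definition flat_sum (s : seq (R * nat)) y : R :=
  \sum_(p <- s) p.1 * flat_exp p.2 y.

Definition deriv_flat_sum (s : seq (R * nat)) : seq (R * nat) :=
  flatten [seq [:: (p.1 * (1 - p.2%:R), p.2.+1); (p.1, p.2.+2)] | p <- s].

Lemma is_derive_flat_sum s y :
  is_derive y (1 : R) (flat_sum s) (flat_sum (deriv_flat_sum s) y).
Proof.
elim: s => [|[c n] s IHs].
  have -> : flat_sum [::] = cst 0 by apply/funext => z; rewrite /flat_sum big_nil.
  exact: is_derive_cst.
have -> : flat_sum ((c, n) :: s) = (c *: flat_exp n : R -> R) + flat_sum s.
  by apply/funext => z; rewrite /flat_sum big_cons.
have dcn := @is_deriveZ _ _ _ _ c _ _ _ (is_derive_flat_exp n y).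
apply: (is_derive_eq (@is_deriveD _ _ _ _ _ y 1 _ _ dcn IHs)).
rewrite {2}/flat_sum /deriv_flat_sum/= !big_cons/=.
by rewrite -/(flat_sum _) /GRing.scale/= /flat_sum; ring.
Qed.

Lemma derive1n_flat_exp n k : exists s, derive1n k (flat_exp n) = flat_sum s.
Proof.
elim: k => [|k [s IHk]].
  exists [:: (1, n)]; apply/funext => y.
  by rewrite /flat_sum big_seq1 mul1r.
exists (deriv_flat_sum s); apply/funext => y.
rewrite derive1nS IHk derive1E.
by have [_ ->] := is_derive_flat_sum s y.
Qed.

End FlatExponential.

Definition smooth_fun (R : realType) (f : R -> R) :=
  forall k x, derivable (derive1n k f) x 1.

Lemma smooth_fun_continuous (R : realType) (f : R -> R) (k : nat) :
  smooth_fun f -> continuous (derive1n k f).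
Proof.
by move=> sf x; apply: differentiable_continuous; exact/derivable1_diffP.
Qed.

Lemma smooth_flat_exp (R : realType) (n : nat) : smooth_fun (@flat_exp R n).
Proof.
move=> k x; have [s ->] := derive1n_flat_exp R n k.
by have [] := is_derive_flat_sum s x.
Qed.

(** The left-hand side is the tangent of [flat_exp 0] at [z], evaluated at [y].
    Dividing by [y > 0] reduces the inequality to [1 + a < exp a] for
    [a = 1 / z - 1 / y]. *)
Lemma flat_exp0_gt_tangent (R : realType) (y z : R) : 0 < z -> y != z ->
  expR (- z^-1) * ((1 + z^-1) * y - 1) < flat_exp 0 y.
Proof.
move=> z0 yz; have [y0|y0] := leP y 0.
  rewrite flat_exp_le0// pmulr_rlt0 ?expR_gt0//.
  have : (1 + z^-1) * y <= 0 by rewrite mulr_ge0_le0// addr_ge0// invr_ge0 ltW.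
  lra.
rewrite /flat_exp y0 expr0 mulr1.
have -> : - y^-1 = - z^-1 + (z^-1 - y^-1) by ring.
rewrite expRD mulrCA ltr_pM2l ?expR_gt0//.
have -> : (1 + z^-1) * y - 1 = y * (1 + (z^-1 - y^-1)).
  by field; rewrite !gt_eqF.
rewrite ltr_pM2l// expR_gt1Dx// subr_eq0.
by apply: contra yz => /eqP/invr_inj->.
Qed.

(** If the intermediate point is positive, the tangent there lies strictly below
    the graph at both ends; otherwise the function vanishes there and is positive
    at one end. *)
Lemma strictly_convex_flat_exp0 (R : realType) (s a b : R) : 0 < s -> s < 1 ->
  a != b -> (0 < a) || (0 < b) ->
  flat_exp 0 (s * a + (1 - s) * b) <
    s * flat_exp 0 a + (1 - s) * flat_exp 0 b.
Proof.
move=> s0 s1 ab ab0; have r0 : 0 < 1 - s by lra.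
have [z0|z0] := ltP 0 (s * a + (1 - s) * b); last first.
  rewrite flat_exp_le0//.
  have pos y : 0 < y -> 0 < flat_exp 0 y.
    by move=> y0; rewrite /flat_exp y0 expr0 mulr1 mulr_gt0 ?expR_gt0.
  case/orP: ab0 => /pos; [rewrite -(pmulr_rgt0 _ s0)|rewrite -(pmulr_rgt0 _ r0)].
    have := flat_exp_ge0 0 b; rewrite -(pmulr_rge0 _ r0); lra.
  have := flat_exp_ge0 0 a; rewrite -(pmulr_rge0 _ s0); lra.
set z := s * a + (1 - s) * b in z0 *.
have za : a != z.
  rewrite -subr_eq0 (_ : a - z = (1 - s) * (a - b)); last by rewrite /z; ring.
  by rewrite mulf_neq0 ?subr_eq0// gt_eqF// subr_gt0.
have zb : b != z.
  rewrite -subr_eq0 (_ : b - z = s * (b - a)); last by rewrite /z; ring.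
  by rewrite mulf_neq0 ?subr_eq0 1?eq_sym// lt_eqF.
have := flat_exp0_gt_tangent z0 za; rewrite -(ltr_pM2l s0) => ha.
have := flat_exp0_gt_tangent z0 zb; rewrite -(ltr_pM2l r0) => hb.
suff -> : flat_exp 0 z = s * (expR (- z^-1) * ((1 + z^-1) * a - 1)) +
    (1 - s) * (expR (- z^-1) * ((1 + z^-1) * b - 1)) by exact: ltrD.
transitivity (expR (- z^-1) * ((1 + z^-1) * z - 1)); last by rewrite {3}/z; ring.
have -> : (1 + z^-1) * z - 1 = z by field; rewrite gt_eqF.
by rewrite /flat_exp z0 expr0 mulr1 mulrC.
Qed.

Lemma convex_flat_exp0 (R : realType) (s a b : R) : 0 < s -> s < 1 ->
  flat_exp 0 (s * a + (1 - s) * b) <=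
    s * flat_exp 0 a + (1 - s) * flat_exp 0 b.
Proof.
move=> s0 s1; have r0 : 0 < 1 - s by lra.
have [->|ab] := eqVneq a b.
  by rewrite -!mulrDl (addrC s) subrK !mul1r.
have [ab0|] := boolP ((0 < a) || (0 < b)).
  exact/ltW/strictly_convex_flat_exp0.
rewrite negb_or -!leNgt => /andP[a0 b0].
by rewrite !flat_exp_le0 ?mulr0 ?addr0//; nra.
Qed.

(** * Averages of translates *)

Lemma continuous_bounded_on_segment (R : realType) (g : R -> R) (B : R) :
  continuous g -> exists2 C, 0 <= C & forall y, `|y| <= B -> `|g y| <= C.
Proof.
move=> cg; have [B0|B0] := leP 0 B; last first.
  by exists 0 => // y yB; have := le_lt_trans yB B0; rewrite normr_lt0.
have BB : - B <= B by rewrite ge0_cp.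
have cng : {within `[- B, B], continuous (fun y => `|g y|)}.
  apply: continuous_subspaceT => y; apply: continuous_comp; first exact: cg.
  exact: norm_continuous.
have [c _ cmax] := EVT_max BB cng.
by exists `|g c| => // y; rewrite ler_norml => yB; apply: cmax; rewrite in_itv.
Qed.

Section ShiftAverage.
Variables (R : realType) (delta : R) (m : R -> R) (M : R).
Hypothesis delta_gt0 : 0 < delta.
Hypothesis measurable_m : measurable_fun `[0, delta] m.
Hypothesis m_ge0 : forall t : R, t \in `[0, delta] -> 0 <= m t.
Hypothesis m_leM : forall t : R, t \in `[0, delta] -> m t <= M.

Let mu := @lebesgue_measure R.

Definition shift_average (g : R -> R) (x : R) : R :=
  \int[mu]_(t in `[0, delta]) g (x - m t).

Lemma norm_shift_le x t : t \in `[0, delta] -> `|x - m t| <= `|x| + M.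
Proof.
move=> td; rewrite (le_trans (ler_normB _ _))// lerD2l ger0_norm; first exact: m_leM.
exact: m_ge0.
Qed.

Lemma measure_segment : mu `[0, delta]%classic = delta%:E.
Proof. by rewrite /mu lebesgue_measure_itv/= lte_fin delta_gt0 sube0. Qed.

Lemma integrable_shift g x : continuous g ->
  mu.-integrable `[0, delta] (EFin \o (fun t => g (x - m t))).
Proof.
move=> cg; apply: measurable_bounded_integrable => //.
- by rewrite [ltLHS]measure_segment ltry.
- apply: (measurableT_comp (continuous_measurable_fun cg)).
  by apply: measurable_funB.
- have [C C0 hC] := continuous_bounded_on_segment (`|x| + M) cg.
  exists C; split; rewrite ?num_real// => B CB t /= td.
  by apply: le_trans (ltW CB); apply: hC; exact: norm_shift_le.
Qed.

(** Differentiation under the integral sign; near [x] the derivative of the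
    integrand is dominated by a constant, since the arguments [y - m t] stay in a
    bounded segment. *)
Lemma is_derive_shift_average (g : R -> R) x :
  (forall y : R, derivable g y 1) -> continuous g^`()%classic ->
  is_derive x (1 : R) (shift_average g) (shift_average g^`()%classic x).
Proof.
move=> dg cg'.
have cg : continuous g.
  by move=> y; apply: differentiable_continuous; exact/derivable1_diffP.
have [C C0 hC] := continuous_bounded_on_segment (`|x| + 1 + M) cg'.
have dshift y t : is_derive y (1 : R) (fun z => g (z - m t)) (g^`()%classic (y - m t)).
  have dgy : is_derive (y - m t) (1 : R) g (g^`()%classic (y - m t)).
    by apply: DeriveDef => //; rewrite derive1E.
  have ds : is_derive y (1 : R) (fun z => z - m t) (1 - 0).
    exact: (@is_deriveB _ _ _ id (cst (m t))).
  by have := @is_derive1_comp _ g (fun z => z - m t) y _ _ dgy ds; rewrite subr0 mulr1.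
pose f x t := g (x - m t).
have d1f y t : partial1of2 f y t = g^`()%classic (y - m t).
  by rewrite partial1of2E; have [_ ->] := dshift y t.
have xI : `]x - 1, x + 1[%classic x by rewrite /= in_itv/=; apply/andP; split; lra.
have mD : measurable (`[0, delta]%classic : set (measurableTypeR R)) by [].
have If y : `]x - 1, x + 1[%classic y -> mu.-integrable `[0, delta] (EFin \o f y).
  by move=> _; exact: integrable_shift.
have df y t : `]x - 1, x + 1[%classic y -> `[0, delta]%classic t ->
    derivable (f ^~ t) y 1.
  by move=> _ _; have [] := dshift y t.
have IC : mu.-integrable `[0, delta] (EFin \o cst C).
  apply: measurable_bounded_integrable => //.
    by rewrite [ltLHS]measure_segment ltry.
  exact: bounded_cst.
have ubC y t : `]x - 1, x + 1[%classic y -> `[0, delta]%classic t ->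
    `|partial1of2 f y t| <= cst C t.
  rewrite /= in_itv/= d1f => /andP[y1 y2] td; apply: hC.
  apply: le_trans (norm_shift_le _ td) _; rewrite lerD2r.
  rewrite -[y](subrK x) addrC (le_trans (ler_normD _ _))// lerD2l ler_norml.
  by apply/andP; split; lra.
apply: DeriveDef.
  exact: (@derivable_under_integral R _ _ mu _ _ mD _ _ _
    xI If df (cst C) (fun=> C0) IC ubC).
rewrite -derive1E.
rewrite (@differentiation_under_integral R _ _ mu _ _ mD _ _ _
  xI If df (cst C) (fun=> C0) IC ubC).
by apply: eq_Rintegral => t _; rewrite d1f.
Qed.

Lemma derive1n_shift_average g k : smooth_fun g ->
  derive1n k (shift_average g) = shift_average (derive1n k g).
Proof.
move=> sg; elim: k => // k IHk; apply/funext => x.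
have cg := @smooth_fun_continuous _ g k.+1 sg.
rewrite derive1nS IHk derive1E.
by have [_ ->] := @is_derive_shift_average (derive1n k g) x (sg k) cg.
Qed.

Lemma smooth_shift_average g : smooth_fun g -> smooth_fun (shift_average g).
Proof.
move=> sg k x; rewrite derive1n_shift_average//.
have cg := @smooth_fun_continuous _ g k.+1 sg.
by have [] := @is_derive_shift_average (derive1n k g) x (sg k) cg.
Qed.

End ShiftAverage.

(** * Sums of ridge functions *)

(** A directional derivative is an ordinary derivative along a line, which brings
    the one-variable chain rule to bear. *)
Lemma is_derive_line (R : numFieldType) (V W : normedModType R)
    (f : V -> W) (x v : V) (d : W) :
  is_derive (0 : R) (1 : R) (fun h => f (h *: v + x)) d -> is_derive x v f d.
Proof.
have quotE : (fun h : R => h^-1 *: (f (h *: v + x) - f x)) =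
    (fun h : R => h^-1 *: (f ((h *: (1 : R) + 0 : R) *: v + x) - f ((0 : R) *: v + x))).
  by apply/funext => h; rewrite addr0 [h *: 1]mulr1 scale0r add0r.
by move=> [fx fd]; split; rewrite /derivable/derive/= quotE.
Qed.

Section RidgeSum.
Variable R : realType.
Implicit Types (f : R -> R) (s : seq (R * (R * R))) (x : R * R).

(** Each ridge is encoded by a coefficient and a linear form on the plane. A
    partial derivative replaces [f] by its derivative and rescales the
    coefficients ([scale_ridges]), so iterated partial derivatives keep this
    shape. *)
Definition ridge_sum f s x : R :=
  \sum_(p <- s) p.1 * f (p.2.1 * x.1 + p.2.2 * x.2).

Definition scale_ridges (i : bool) s : seq (R * (R * R)) :=
  [seq (p.1 * (if i then p.2.2 else p.2.1), p.2) | p <- s].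

Lemma ridge_sum_cons f p s :
  ridge_sum f (p :: s) =
    (p.1 *: (fun x => f (p.2.1 * x.1 + p.2.2 * x.2)) : R * R -> R) +
    ridge_sum f s.
Proof. by apply/funext => x; rewrite /ridge_sum big_cons. Qed.

Lemma ridge_sum_nil f : ridge_sum f [::] = cst 0.
Proof. by apply/funext => x; rewrite /ridge_sum big_nil. Qed.

Lemma is_derive_ridge_sum f s x i :
  (forall y : R, derivable f y 1) ->
  is_derive x (coord_vec R i) (ridge_sum f s)
    (ridge_sum f^`()%classic (scale_ridges i s) x).
Proof.
move=> df; elim: s => [|[c [a b]] s IHs].
  by rewrite !ridge_sum_nil; exact: is_derive_cst.
rewrite /scale_ridges/= -/(scale_ridges i s) !ridge_sum_cons/=.
set k := if i then b else a.
set y := a * x.1 + b * x.2.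
have dfy : is_derive (0 * k + y) (1 : R) f (f^`()%classic y).
  by rewrite mul0r add0r; apply: DeriveDef => //; rewrite derive1E.
have dl : is_derive (0 : R) (1 : R) (fun h => h * k + y) k.
  have -> : (fun h : R => h * k + y) = k *: (id : R -> R) + cst y.
    by apply/funext => h; rewrite mulrC.
  by apply: is_derive_eq; rewrite addr0 [k *: 1]mulr1.
have dr : is_derive x (coord_vec R i) (fun z => f (a * z.1 + b * z.2))
    (f^`()%classic y * k).
  apply: is_derive_line.
  have -> : (fun h : R => f (a * (h *: coord_vec R i + x).1 +
                             b * (h *: coord_vec R i + x).2)) =
            f \o (fun h => h * k + y).
    apply/funext => h; congr (f _); rewrite /k /y /coord_vec.
    by case: (i); rewrite /= /GRing.scale/=; ring.
  exact: is_derive1_comp.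
have dcr := @is_deriveZ _ _ _ _ c _ _ _ dr.
apply: (is_derive_eq (@is_deriveD _ _ _ _ _ x _ _ _ dcr IHs)).
by rewrite [f^`()%classic y * k]mulrC [c *: _]mulrA.
Qed.

Lemma continuous_ridge_sum f s : continuous f -> continuous (ridge_sum f s).
Proof.
move=> cf; elim: s => [|p s IHs] x.
  by rewrite ridge_sum_nil; exact: cvg_cst.
rewrite ridge_sum_cons; apply: cvgD; last exact: IHs.
apply: cvgMr; apply: (@continuous_comp _ _ _ (fun z : R * R => _) f); last exact: cf.
by apply: cvgD; apply: cvgMr; [exact: cvg_fst | exact: cvg_snd].
Qed.

Lemma iter_partial_ridge_sum f s (w : seq bool) : smooth_fun f ->
  exists s', iter_partial w (ridge_sum f s) = ridge_sum (derive1n (size w) f) s'.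
Proof.
move=> sf; elim: w => [|i w [s' IHw]]; first by exists s.
exists (scale_ridges i s'); apply/funext => x.
have [_ <-] := is_derive_ridge_sum s' x i (sf (size w)).
by rewrite -IHw.
Qed.

Lemma smooth_ridge_sum f s (U : set (R * R)) : smooth_fun f ->
  smooth_on_open U (ridge_sum f s).
Proof.
move=> sf w x _; have [s' ->] := iter_partial_ridge_sum s w sf; split.
  by apply: continuous_ridge_sum; exact: smooth_fun_continuous.
by move=> i; have [] := is_derive_ridge_sum s' x i (sf (size w)).
Qed.

End RidgeSum.

(** * A smooth strictly convex function of prescribed flatness *)

Lemma Rintegral_segment_gt0 (R : realType) (delta t1 : R) (g : R -> R) :
  (@lebesgue_measure R).-integrable `[0, delta] (EFin \o g) ->
  (forall t, t \in `[0, delta] -> 0 <= g t) ->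
  0 < t1 -> t1 <= delta ->
  (forall t, t \in `[0, t1] -> 0 < g t) ->
  0 < \int[@lebesgue_measure R]_(t in `[0, delta]) g t.
Proof.
move=> ig g0 t10 t1d gpos.
rewrite lt_neqAle Rintegral_ge0// andbT eq_sym; apply/eqP => ig0.
have mD : measurable (`[0, delta]%classic : set (measurableTypeR R)) by [].
have mg : measurable_fun `[0, delta] (EFin \o g) by case/integrableP : ig.
have : (\int[@lebesgue_measure R]_(t in `[0%R, delta]) `|(EFin \o g) t| = 0)%E.
  rewrite (@eq_integral _ (measurableTypeR R) _ _ _ (EFin \o g)) => [|t]; last first.
    by rewrite inE => td; rewrite /= ger0_norm// g0.
  by rewrite -(fineK (integrable_fin_num mD ig)); congr _%:E.
move/(ae_eq_integral_abs _ mD mg) => -[A [mA A0 subA]].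
have : (@lebesgue_measure R `[0%R, t1] <= @lebesgue_measure R A)%E.
  apply: le_measure; rewrite ?inE//.
  move=> t tt1; apply: subA => /= gt0.
  have : `[0, delta]%classic t by move: tt1; apply: subset_itvl; rewrite bnd_simp.
  by move/gt0 => [gt0']; have := gpos _ tt1; rewrite gt0' ltxx.
by rewrite A0 lebesgue_measure_itv/= lte_fin t10 sube0 lee_fin leNgt t10.
Qed.

Lemma flat_exp0_nondecreasing (R : realType) (y z : R) : y <= z ->
  flat_exp 0 y <= flat_exp 0 z.
Proof.
move=> yz; have [y0|y0] := leP y 0; first by rewrite flat_exp_le0// flat_exp_ge0.
have z0 : 0 < z by exact: lt_le_trans yz.
rewrite /flat_exp y0 z0 !expr0 !mulr1 ler_pM ?expR_ge0 ?(ltW y0)//.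
by rewrite ler_expR lerN2 lef_pV2 ?posrE.
Qed.

Section FlatConvexFunction.
Variables (R : realType) (delta : R) (m : R -> R).
Hypothesis delta_gt0 : 0 < delta.
Hypothesis nondecreasing_m : nondecreasing_fun m.
Hypothesis m_ge0 : forall t : R, 0 <= t -> 0 <= m t.
Hypothesis m_small : forall e : R, 0 < e ->
  exists t, [/\ 0 < t, t <= delta & m t < e].

Definition flat_convex : R -> R := shift_average delta m (flat_exp 0).

Let measurable_m : measurable_fun `[0, delta] m.
Proof. exact: nondecreasing_measurable. Qed.

Let m_ge0_segment (t : R) : t \in `[0, delta] -> 0 <= m t.
Proof. by rewrite in_itv/= => /andP[t0 _]; exact: m_ge0. Qed.

Let m_le_segment (t : R) : t \in `[0, delta] -> m t <= m delta.
Proof. by rewrite in_itv/= => /andP[_ td]; exact: nondecreasing_m. Qed.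

Let integrable_shift_flat x :
  (@lebesgue_measure R).-integrable `[0, delta]
    (EFin \o (fun t => flat_exp 0 (x - m t))).
Proof.
apply: (integrable_shift delta_gt0 measurable_m m_ge0_segment m_le_segment).
exact: (@smooth_fun_continuous _ _ 0 (@smooth_flat_exp R 0)).
Qed.

Lemma smooth_flat_convex : smooth_fun flat_convex.
Proof.
apply: (smooth_shift_average delta_gt0 measurable_m m_ge0_segment m_le_segment).
exact: smooth_flat_exp.
Qed.

Lemma flat_convex_ge0 x : 0 <= flat_convex x.
Proof. by apply: Rintegral_ge0 => t _; exact: flat_exp_ge0. Qed.

Lemma flat_convex_le0 x : x <= 0 -> flat_convex x = 0.
Proof.
move=> x0; rewrite /flat_convex /shift_average.
rewrite (@eq_Rintegral _ _ _ _ _ (cst 0)) ?Rintegral_cst ?mul0r// => t.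
by rewrite inE => /m_ge0_segment mt; rewrite flat_exp_le0//= subr_le0 (le_trans x0).
Qed.

(** For [r > t] the argument [m t - m r] is nonpositive, so only [[0, t]]
    contributes to the integral. *)
Lemma flat_convex_le t : 0 <= t -> t <= delta ->
  flat_convex (m t) <= t * flat_exp 0 (m t).
Proof.
move=> t0 td; set c := flat_exp 0 (m t).
have sub : `[0, t]%classic `<=` `[0, delta]%classic.
  by apply: subset_itvl; rewrite bnd_simp.
have -> : flat_convex (m t) =
    \int[@lebesgue_measure R]_(r in `[0, t]) flat_exp 0 (m t - m r).
  rewrite -(setIidr sub) Rintegral_mkcondr; apply: eq_Rintegral => r.
  rewrite inE/= in_itv/= => /andP[r0 _]; rewrite patchE; case: ifPn => //.
  rewrite notin_setE/= in_itv/= r0/= => /negP; rewrite -ltNge => tr.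
  by rewrite flat_exp_le0// subr_le0 nondecreasing_m// ltW.
have mt : measurable (`[0, t]%classic : set (measurableTypeR R)) by [].
have lt : fine (@lebesgue_measure R `[0, t]%classic) = t.
  by rewrite lebesgue_measure_itv/= lte_fin; move: t0; rewrite le_eqVlt =>
    /predU1P[<-|->]; rewrite ?ltxx ?sube0.
have -> : t * c = \int[@lebesgue_measure R]_(r in `[0, t]) c.
  by rewrite Rintegral_cst// lt mulrC.
apply: le_Rintegral => //.
- exact: (integrableS _ mt sub (integrable_shift_flat (m t))).
- apply: measurable_bounded_integrable => //; last exact: bounded_cst.
  by rewrite [ltLHS]lebesgue_measure_itv/=; case: ifP => _; rewrite ?sube0 ltry.
- move=> r /= /[!in_itv]/= /andP[r0 _].
  by apply: flat_exp0_nondecreasing; rewrite gerBl m_ge0.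
Qed.

Let shift_mid s a b t :
  s * a + (1 - s) * b - m t = s * (a - m t) + (1 - s) * (b - m t).
Proof. by ring. Qed.

Let integrable_mid s a b :
  (@lebesgue_measure R).-integrable `[0, delta]
    (EFin \o (fun t => s * flat_exp 0 (a - m t) + (1 - s) * flat_exp 0 (b - m t))).
Proof.
have := integrableD _ (integrableZl _ s (integrable_shift_flat a))
  (integrableZl _ (1 - s) (integrable_shift_flat b)).
exact.
Qed.

Let integrable_gap s a b :
  (@lebesgue_measure R).-integrable `[0, delta]
    (EFin \o (fun t => s * flat_exp 0 (a - m t) + (1 - s) * flat_exp 0 (b - m t) -
       flat_exp 0 (s * (a - m t) + (1 - s) * (b - m t)))).
Proof.
apply: eq_integrable (integrableB _ (integrable_mid s a b)
  (integrable_shift_flat (s * a + (1 - s) * b))) => // t _ /=.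
by rewrite EFinB shift_mid.
Qed.

(** Convexity of the average is read off from the integrand, which is the
    convexity gap of [flat_exp 0]. *)
Lemma flat_convex_gap s a b :
  s * flat_convex a + (1 - s) * flat_convex b - flat_convex (s * a + (1 - s) * b)
  = \int[@lebesgue_measure R]_(t in `[0, delta])
      (s * flat_exp 0 (a - m t) + (1 - s) * flat_exp 0 (b - m t) -
       flat_exp 0 (s * (a - m t) + (1 - s) * (b - m t))).
Proof.
have mD : measurable (`[0, delta]%classic : set (measurableTypeR R)) by [].
have Ia := integrable_shift_flat a; have Ib := integrable_shift_flat b.
rewrite -(RintegralZl _ mD Ia) -(RintegralZl _ mD Ib) -RintegralD//; last 2 first.
- exact: (integrableZl mD s Ia).
- exact: (integrableZl mD (1 - s) Ib).
rewrite -RintegralB//.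
by apply: eq_Rintegral => t _; rewrite shift_mid.
Qed.

Lemma convex_flat_convex s a b : 0 < s -> s < 1 ->
  flat_convex (s * a + (1 - s) * b) <=
    s * flat_convex a + (1 - s) * flat_convex b.
Proof.
move=> s0 s1; rewrite -subr_ge0 flat_convex_gap; apply: Rintegral_ge0 => t _.
by rewrite subr_ge0 convex_flat_exp0.
Qed.

Lemma strictly_convex_flat_convex s a b : 0 < s -> s < 1 ->
  a != b -> (0 < a) || (0 < b) ->
  flat_convex (s * a + (1 - s) * b) <
    s * flat_convex a + (1 - s) * flat_convex b.
Proof.
move=> s0 s1 ab ab0; rewrite -subr_gt0 flat_convex_gap.
(* On [[0, t1]] one of [a - m t], [b - m t] is positive, so the gap of
   [flat_exp 0] is positive there. *)
have e0 : 0 < Num.max a b by rewrite lt_max.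
have [t1 [t10 t1d mt1]] := m_small e0.
apply: (Rintegral_segment_gt0 (t1 := t1)) => //.
  by move=> t _; rewrite subr_ge0 convex_flat_exp0.
move=> t; rewrite in_itv/= => /andP[_ tt1].
rewrite subr_gt0 strictly_convex_flat_exp0//.
  by apply: contra ab => /eqP/addIr->.
by rewrite !subr_gt0 -lt_max (le_lt_trans _ mt1)// nondecreasing_m.
Qed.

End FlatConvexFunction.

(** * The pyramid *)

Section Pyramid.
Variable R : realType.
Implicit Types (x y z : R * R) (i : bool).

Definition pyramid x : R := Num.max 0 (2^-1 - `|x|).

Definition coordinate i x : R := if i then x.2 else x.1.

Lemma prod_norm_coordinate i x :
  `|x| = Num.max `|coordinate i x| `|coordinate (~~ i) x|.
Proof. by case: i => //; rewrite maxC. Qed.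

Lemma pyramid_ge0 x : 0 <= pyramid x.
Proof. by rewrite le_max lexx. Qed.

Lemma unit_diskE : unit_disk R = [set x | x.1 ^+ 2 + x.2 ^+ 2 < 1].
Proof.
have normE x : (enorm x < 1) = (x.1 ^+ 2 + x.2 ^+ 2 < 1).
  by rewrite /enorm -[X in _ < X](@sqrtr1 R) ltr_sqrt.
by apply/seteqP; split => x; rewrite /unit_disk/= normE.
Qed.

Lemma open_unit_disk : open (unit_disk R).
Proof.
rewrite unit_diskE.
apply: (@open_comp _ _ (fun x : R * R => x.1 ^+ 2 + x.2 ^+ 2) [set t | t < 1]).
  move=> x _; apply: cvgD.
    exact: (cvgM cvg_fst cvg_fst).
  exact: (cvgM cvg_snd cvg_snd).
exact: open_lt.
Qed.

Lemma lipschitz_pyramid : [lipschitz pyramid x | x in unit_disk R].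
Proof.
apply: (@klipschitzW _ _ _ 1).
  apply: (@globally_properfilter _ _ ((0, 0), (0, 0))); split => /=;
  by rewrite unit_diskE /= expr0n/= addr0.
move=> [x y] /= _; rewrite mul1r.
apply: le_trans (ler_dist_dist x y).
rewrite /self_sub/= /pyramid; move: `|x| `|y| => p q.
rewrite ler_norml; have := ler_norm (p - q); have := ler_norm (q - p).
rewrite (distrC q p) => qp pq; apply/andP.
by case: (leP 0 (2^-1 - p)) => ?; case: (leP 0 (2^-1 - q)) => ?; split; lra.
Qed.

Lemma compact_support_pyramid : compactly_supported_in (unit_disk R) pyramid.
Proof.
pose S : set (R * R) := `[- 2^-1, 2^-1] `*` `[- 2^-1, 2^-1].
have cS : compact S by apply: compact_setX; exact: segment_compact.
have supp : closure [set x | unit_disk R x /\ pyramid x <> 0] `<=` S.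
  rewrite [X in _ `<=` X](closure_id S).1; last first.
    by apply: compact_closed => //; exact: norm_hausdorff.
  apply: closure_subset => x [_ /eqP px].
  have xn : `|x| <= 2^-1.
    move: px; apply: contraNT; rewrite -ltNge /pyramid => xn.
    by rewrite max_l// subr_le0 ltW.
  move: xn; rewrite (prod_norm_coordinate false) ge_max /= => /andP[x1 x2].
  by split => /=; rewrite in_itv/= -ler_norml.
split; first exact: (subclosed_compact (@closed_closure _ _) cS supp).
apply: (subset_trans supp) => x [/=]; rewrite !in_itv/= -!ler_norml => x1 x2.
rewrite unit_diskE /= -[x.1 ^+ 2]real_normK ?num_real// -[x.2 ^+ 2]real_normK ?num_real//.
by have := normr_ge0 x.1; have := normr_ge0 x.2; nra.
Qed.

(** Replacing the norm by a linear form [l] below it can only raise the pyramid,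
    and changes nothing on [U]; the result is a maximum of two affine functions. *)
Lemma convex_pyramid (U : set (R * R)) (l : R * R -> R) :
  (forall (t : R) x y, l (t *: x + (1 - t) *: y) = t * l x + (1 - t) * l y) ->
  (forall z, l z <= `|z|) -> (forall z, U z -> `|z| = l z) ->
  convex_function U pyramid.
Proof.
move=> l_aff l_le Ul t x y; rewrite !inE => Ux Uy.
suff conv s : 0 <= s -> s <= 1 -> pyramid (s *: (x : R * R) + (1 - s) *: (y : R * R))
    <= s * pyramid x + (1 - s) * pyramid y by exact: conv.
move=> s0 s1.
rewrite {1}/pyramid ge_max; apply/andP; split.
  by rewrite addr_ge0// mulr_ge0 ?pyramid_ge0// subr_ge0.
have pyramid_le z : U z -> 2^-1 - l z <= pyramid z.
  by move=> /Ul <-; rewrite le_max lexx orbT.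
apply: (@le_trans _ _ (2^-1 - l (s *: x + (1 - s) *: y))); first by rewrite lerB.
rewrite l_aff; have := pyramid_le _ Ux; have := pyramid_le _ Uy; nra.
Qed.

Lemma convexity_region_pyramid x :
  unit_disk R x -> `|x.1| != `|x.2| -> convexity_region (unit_disk R) pyramid x.
Proof.
move=> Dx x12.
have [i xi] : exists i, `|coordinate (~~ i) x| < `|coordinate i x|.
  by case: ltgtP x12 => // x12 _; [exists true|exists false].
(* In the sector around [x], the norm is the linear form [e * coordinate i]. *)
pose e := Num.sg (coordinate i x).
have ne : `|e| = 1.
  by rewrite normr_sg; case: eqP => // x0; move: xi; rewrite x0 normr0 normr_lt0.
exists (unit_disk R `&`
  [set y | `|coordinate (~~ i) y| < e * coordinate i y]); last first.
  by split => //=; rewrite /e -normrEsg.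
split.
- apply: openI; first exact: open_unit_disk.
  have -> : [set y | `|coordinate (~~ i) y| < e * coordinate i y] =
      (fun y => e * coordinate i y - `|coordinate (~~ i) y|) @^-1` [set t | 0 < t].
    by apply/seteqP; split => y /=; rewrite subr_gt0.
  have ccrd j : continuous (coordinate j).
    by case: j => y; [exact: cvg_snd|exact: cvg_fst].
  apply: open_comp; last exact: open_gt.
  move=> y _; apply: cvgB; first by apply: cvgMr; exact: ccrd.
  by apply: cvg_norm; exact: ccrd.
- by move=> y [].
- apply: (@convex_pyramid _ (fun y => e * coordinate i y)).
  + by move=> t y z; rewrite /coordinate; case: (i) => /=; rewrite /GRing.scale/=; ring.
  + move=> z; rewrite (prod_norm_coordinate i) le_max.
    by rewrite (le_trans (ler_norm _))// normrM ne mul1r.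
  + move=> z [_ /= zi]; rewrite (prod_norm_coordinate i).
    have ei : `|coordinate i z| = e * coordinate i z.
      by rewrite -[LHS]mul1r -ne -normrM ger0_norm// (le_trans _ (ltW zi)).
    by rewrite ei max_l// ltW.
Qed.

(** The part of the disk outside the convexity region lies on the two diagonals,
    which meet every vertical line in at most two points. *)
Lemma plane_measure_nonconvexity_pyramid :
  plane_measure (unit_disk R `\` convexity_region (unit_disk R) pyramid) = 0%E.
Proof.
rewrite /plane_measure /product_measure1; apply: integral0_eq => x _ /=.
apply: countable_lebesgue_measure0.
apply: (@sub_countable _ _ _ [set x; - x]); last first.
  by apply: finite_set_countable; exact: finite_set2.
apply: subset_card_le => y; rewrite /xsection/= inE => -[Dxy nconv].
have : `|y| == `|x : R|.
  rewrite eq_sym; apply: contra_notT nconv.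
  exact: (@convexity_region_pyramid (x, y)).
by rewrite eqr_norm2 => /orP[]/eqP ->; [left|right].
Qed.

End Pyramid.

(** * The gap at the origin *)

(** The existence of an affine minorant keeps the supremum from taking its default
    value. *)
Lemma Gamma_reg_midpoint_le (R : realType) (V : lmodType R) (A : set V)
    (w : V -> R) (p q : V) : A p -> A q ->
  (exists2 a, affine_function a & forall y, A y -> a y <= w y) ->
  Gamma_reg A w (2^-1 *: (p + q)) <= 2^-1 * (w p + w q).
Proof.
move=> Ap Aq [a0 aff0 le0]; apply: ge_sup.
  by exists (a0 (2^-1 *: (p + q))), a0.
move=> _ [a [[l [c ac]] aw] <-]; rewrite ac linearZ linearD /=.
by have := aw _ Ap; have := aw _ Aq; rewrite !ac; lra.
Qed.

Lemma limf_einf_ge (R : realType) (F : set_system R) (f : R -> \bar R) (c : \bar R) :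
  (\forall t \near F, (c <= f t)%E) -> (c <= limf_einf f F)%E.
Proof.
move=> cf; rewrite limf_einfE.
apply: (@le_trans _ _ (ereal_inf (f @` [set t | (c <= f t)%E]))).
  by apply/ereal_infP => _ [t ct <-].
by apply: ereal_sup_ubound; exists [set t | (c <= f t)%E].
Qed.

Section FourRidges.
Variables (R : realType) (f : R -> R).

Definition axial_sum : R * R -> R :=
  ridge_sum f [:: (1, (1, 0)); (1, (-1, 0)); (1, (0, 1)); (1, (0, -1))].

Lemma axial_sumE x : axial_sum x = f x.1 + f (- x.1) + f x.2 + f (- x.2).
Proof.
rewrite /axial_sum /ridge_sum !big_cons big_nil /=.
by rewrite !mul1r !mulN1r !mul0r !addr0 !add0r !addrA.
Qed.

Lemma smooth_on_axial_sum (A : set (R * R)) : smooth_fun f ->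
  smooth_on A axial_sum.
Proof.
move=> sf; exists setT, axial_sum; split => //; first exact: openT.
exact: smooth_ridge_sum.
Qed.

(** In each coordinate, [f a + f (- a)] is strictly convex: if neither of two
    distinct points is positive, one of their opposites is. *)
Lemma strictly_convex_axial_sum (A : set (R * R)) :
  (forall s a b, 0 < s -> s < 1 ->
    f (s * a + (1 - s) * b) <= s * f a + (1 - s) * f b) ->
  (forall s a b, 0 < s -> s < 1 -> a != b -> (0 < a) || (0 < b) ->
    f (s * a + (1 - s) * b) < s * f a + (1 - s) * f b) ->
  strictly_convex_on A axial_sum.
Proof.
move=> cf scf.
pose g a := f a + f (- a).
have cg s a b : 0 < s -> s < 1 -> g (s * a + (1 - s) * b) <= s * g a + (1 - s) * g b.
  move=> s0 s1; have := cf s a b s0 s1; have := cf s (- a) (- b) s0 s1.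
  rewrite /g opprD -!mulrN; lra.
have scg s a b : 0 < s -> s < 1 -> a != b ->
    g (s * a + (1 - s) * b) < s * g a + (1 - s) * g b.
  move=> s0 s1 ab; rewrite /g opprD -!mulrN.
  have nab : - a != - b by rewrite eqr_opp.
  have [ab0|] := boolP ((0 < a) || (0 < b)).
    by have := scf s a b s0 s1 ab ab0; have := cf s (- a) (- b) s0 s1; lra.
  rewrite negb_or -!leNgt => /andP[a0 b0].
  have ab0 : (0 < - a) || (0 < - b).
    rewrite !oppr_gt0; case: ltgtP a0 => //= a0 _.
    by rewrite lt_neqAle b0 andbT eq_sym -a0.
  by have := scf s _ _ s0 s1 nab ab0; have := cf s a b s0 s1; lra.
move=> [x1 x2] [y1 y2] s _ _ xy s0 s1; rewrite !axial_sumE /=.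
rewrite -[s *: x1]/(s * x1) -[s *: x2]/(s * x2).
rewrite -[(1 - s) *: y1]/((1 - s) * y1) -[(1 - s) *: y2]/((1 - s) * y2).
have := cg s x1 y1 s0 s1; have := cg s x2 y2 s0 s1.
have [x1y1|/(scg s _ _ s0 s1)] := eqVneq x1 y1; last by rewrite /g; lra.
have [x2y2|/(scg s _ _ s0 s1)] := eqVneq x2 y2; last by rewrite /g; lra.
by exfalso; apply: xy; rewrite x1y1 x2y2.
Qed.

End FourRidges.

Theorem theorem2p1 (R : realType) (delta : R) (phi : R -> R)
    (delta_gt0 : 0 < delta)
    (phi0 : phi 0 = 0)
    (phi_gt0 : forall t : R, 0 < t -> t <= delta -> 0 < phi t)
    (phi_nondecreasing : forall s t : R,
       0 <= s -> s <= t -> t <= delta -> phi s <= phi t)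
    (phi_cvg0 : phi t @[t --> (0 : R)^'+] --> (0 : R)) :
  exists u h : R * R -> R,
    [/\ smooth_on (closure (unit_disk R)) u,
        strictly_convex_on (closure (unit_disk R)) u,
        [lipschitz h x | x in unit_disk R] /\
          compactly_supported_in (unit_disk R) h,
        plane_measure (unit_disk R `\` convexity_region (unit_disk R) h)
          = 0%E
      & let u_ (t : R) := fun x : R * R => u x + t * h x in
        (0 < limf_einf
               (fun t : R =>
                  ((u_ t (0, 0) - Gamma_reg (unit_disk R) (u_ t) (0, 0))
                     / (t * phi t))%:E)
               ((0 : R)^'+))%E].
Proof.
(* [phi] is controlled on [[0, delta]] only; clamping its argument makes it
   nondecreasing, hence measurable, on the whole line. *)
pose clamp t := Num.max 0 (Num.min t delta).
pose m t := phi (clamp t).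
have clampE t : 0 <= t -> t <= delta -> clamp t = t.
  by move=> t0 td; rewrite /clamp min_l// max_r.
have clamp_ge0 t : 0 <= clamp t by rewrite le_max lexx.
have clamp_le t : clamp t <= delta by rewrite ge_max ge_min lexx orbT ltW.
have nd_m : nondecreasing_fun m.
  move=> s t st; apply: phi_nondecreasing => //.
  by rewrite /clamp ge_max !le_max !le_min !ge_min !lexx st !orbT.
have m_ge0 t : 0 <= t -> 0 <= m t.
  by move=> _; rewrite -phi0; exact: phi_nondecreasing.
have phi_lt e : 0 < e -> \forall t \near 0^'+, phi t < e.
  by move=> e0; exact: cvgr_lt phi_cvg0 _ e0.
have m_small e : 0 < e -> exists t, [/\ 0 < t, t <= delta & m t < e].
  move=> e0; near (0 : R)^'+ => t.
  have t0 : 0 < t by near: t; exact: nbhs_right_gt.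
  have td : t <= delta by near: t; exact: nbhs_right_le.
  exists t; split => //; rewrite /m clampE ?ltW//.
  by near: t; exact: phi_lt.
pose f := flat_convex delta m.
have f_ge0 y : 0 <= f y by exact: flat_convex_ge0.
have fle0 y : y <= 0 -> f y = 0 by exact: flat_convex_le0.
exists (axial_sum f), (@pyramid R); split.
- exact/smooth_on_axial_sum/smooth_flat_convex.
- apply: strictly_convex_axial_sum => s a b.
    exact: convex_flat_convex.
  exact: strictly_convex_flat_convex.
- by split; [exact: lipschitz_pyramid|exact: compact_support_pyramid].
- exact: plane_measure_nonconvexity_pyramid.
move=> u_.
apply: (@lt_le_trans _ _ (2^-1)%:E); first by rewrite lte_fin invr_gt0.
apply: limf_einf_ge; near=> t.
have t0 : 0 < t by near: t; exact: nbhs_right_gt.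
have td : t <= delta by near: t; exact: nbhs_right_le.
have s2 : phi t < 2^-1 by near: t; apply: phi_lt; rewrite invr_gt0.
have s0 : 0 < phi t by exact: phi_gt0.
rewrite lee_fin ler_pdivlMr ?mulr_gt0//.
(* [exp (- 1 / phi t) <= 1 / 2], because [1 + 1 / phi t <= exp (1 / phi t)]. *)
have fs : f (phi t) <= t * (phi t * 2^-1).
  have mt : m t = phi t by rewrite /m clampE ?ltW.
  have := flat_convex_le delta_gt0 nd_m m_ge0 (ltW t0) td.
  rewrite mt => /le_trans; apply.
  rewrite ler_wpM2l ?(ltW t0)// /flat_exp s0 expr0 mulr1 ler_wpM2l ?(ltW s0)// expRN.
  rewrite lef_pV2 ?posrE ?expR_gt0//.
  have : 1 <= (phi t)^-1 by rewrite invf_ge1//; lra.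
  have := @expR_ge1Dx R (phi t)^-1; lra.
have Ds e : `|e| = phi t -> unit_disk R (e, 0).
  by move=> es; rewrite unit_diskE /= expr0n addr0 -real_normK ?num_real// es; nra.
have hs e : `|e| = phi t -> pyramid (e, 0) = 2^-1 - phi t.
  move=> es; rewrite /pyramid (prod_norm_coordinate false) /= normr0 es.
  by rewrite (max_l (ltW s0)) max_r// subr_ge0 ltW.
have us e : `|e| = phi t -> u_ t (e, 0) = f (phi t) + t * (2^-1 - phi t).
  move=> es; rewrite /u_ hs// axial_sumE /= oppr0 (fle0 0)// !addr0.
  congr (_ + _); rewrite -es; have [e0|e0] := leP 0 e.
    by rewrite (fle0 (- e)) ?oppr_le0// addr0 ger0_norm.
  by rewrite (fle0 e) ?ltW// add0r ltr0_norm.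
have u0 : u_ t (0, 0) = t * 2^-1.
  rewrite /u_ axial_sumE /= oppr0 (fle0 0)// !add0r /pyramid normr0 subr0.
  by rewrite max_r// invr_ge0.
have norms : `|phi t| = phi t by rewrite gtr0_norm.
have normNs : `|- phi t| = phi t by rewrite normrN gtr0_norm.
have := @Gamma_reg_midpoint_le R _ (unit_disk R) (u_ t) _ _ (Ds _ norms) (Ds _ normNs).
have -> : 2^-1 *: ((phi t, 0) + (- phi t, 0)) = (0, 0) :> R * R.
  by congr pair; rewrite /= ?addr0 ?subrr; exact: mulr0.
rewrite (us _ norms) (us _ normNs) u0.
have minorant : exists2 a : R * R -> R,
    affine_function a & forall y, unit_disk R y -> a y <= u_ t y.
  exists (cst 0).
    by exists \0, 0 => y /=; rewrite addr0.
  move=> y _; rewrite /u_ /= axial_sumE !addr_ge0//.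
  by rewrite mulr_ge0 ?pyramid_ge0 ?ltW.
by move=> /(_ minorant); move: (Gamma_reg _ _ _) => G; nra.
Unshelve. all: by end_near. Qed.
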